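(* Let $G=(V,E)$ be a finite undirected weighted graph with $V=\{1,\dots,n\}$ and all degrees $d_i>0$, let $d\ge 1$, and let $\rho:E\to O(d)$ be given with $\rho_{ji}=\rho_{ij}^{-1}$. Let $\lambda_i(\mathcal{L}_1)$ and $\lambda_i(\mathcal{L}_0)$ denote the $i$-th smallest eigenvalues of the normalized graph Connection Laplacian $\mathcal{L}_1$ and of the normalized graph Laplacian $\mathcal{L}_0$ respectively, and assume $\lambda_2(\mathcal{L}_0)>0$. Let $\nu_G$ denote the $O(d)$ frustration constant of $G$. Then $$\frac1d\sum_{i=1}^d\lambda_i(\mathcal{L}_1)\;\le\;\nu_G\;\le\;1026\,d^3\,\frac{1}{\lambda_2(\mathcal{L}_0)}\sum_{i=1}^d\lambda_i(\mathcal{L}_1).$$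
   Context: $G$ is a simple graph with symmetric weights $w_{ij}=w_{ji}$, $w_{ij}>0$ if $(i,j)\in E$ and $w_{ij}=0$ otherwise; $d_i=\sum_j w_{ij}$ and $\mathrm{vol}(G)=\sum_i d_i$. $O(d)$ is the group of $d\times d$ real orthogonal matrices. Sums $\sum_{i,j}$ run over all ordered pairs of vertices (terms with $w_{ij}=0$ vanish, so $\rho_{ij}$ is needed only on edges). Graph Laplacian: $W_0=(w_{ij})\in\mathbb{R}^{n\times n}$, $D_0=\mathrm{diag}(d_1,\dots,d_n)$, $\mathcal{L}_0=I-D_0^{-1/2}W_0D_0^{-1/2}$. Connection Laplacian: $W_1\in\mathbb{R}^{dn\times dn}$ is the symmetric matrix whose $(i,j)$-th $d\times d$ block is $w_{ij}\rho_{ij}$, $D_1\in\mathbb{R}^{dn\times dn}$ is block diagonal with $i$-th diagonal block $d_iI_{d\times d}$, and $\mathcal{L}_1=I-D_1^{-1/2}W_1D_1^{-1/2}$. Eigenvalues are listed in increasing order with multiplicity. The frustration of $g:V\to O(d)$ is $\nu(g)=\frac{1}{2d}\frac{1}{\mathrm{vol}(G)}\sum_{i,j}w_{ij}\|g_i-\rho_{ij}g_j\|_F^2$ ($\|\cdot\|_F$ the Frobenius norm), and $\nu_G=\min_{g:V\to O(d)}\nu(g)$. *)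

(* Defs.v *)
From HB Require Import structures.
From mathcomp Require Import all_boot all_order all_algebra.
From mathcomp Require Import polyrcf complex.
From mathcomp Require Import all_classical all_reals all_analysis.
Import Order.TTheory GRing.Theory Num.Theory.
Import numFieldNormedType.Exports.

Set Implicit Arguments.
Unset Strict Implicit.
Unset Printing Implicit Defensive.

Local Open Scope classical_set_scope.
Local Open Scope ring_scope.

Section Spectrum.
Variables (R : realType) (m : nat).
Implicit Types A : 'M[R]_m.

(* The real eigenvalues of A in increasing order, each one repeated according
   to its multiplicity as a root of the characteristic polynomial; for
   symmetric A these are all m eigenvalues, see spectrum_symmetric. *)
Definition spectrum A : seq R :=
  flatten [seq nseq (mup x (char_poly A)) x | x <- rootsR (char_poly A)].

(* The k-th smallest eigenvalue, counted from k = 1. *)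
Definition lambda (k : nat) A : R := (spectrum A)`_k.-1.

(* D^(-1/2) for a diagonal matrix D with positive diagonal. *)
Definition diag_invsqrt A : 'M[R]_m := diag_mx (\row_i (Num.sqrt (A i i))^-1).

Definition normalized_laplacian (D W : 'M[R]_m) : 'M[R]_m :=
  1%:M - diag_invsqrt D *m W *m diag_invsqrt D.

Lemma spectrum_sorted A : sorted <=%R (spectrum A).
Proof.
rewrite /spectrum; set p := char_poly A.
have: sorted <%R (rootsR p) by exact: sorted_roots.
elim: rootsR => //= x s IH xs.
have /IH {}IH := path_sorted xs.
have /allP xs' : all (>= x) (flatten [seq nseq (mup y p) y | y <- s]).
  apply/allP => z /flattenP [_ /mapP [y ys ->]].
  rewrite mem_nseq => /andP [_ /eqP ->] /=; apply/ltW.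
  by move: xs; rewrite (path_sortedE lt_trans) => /andP [/allP/(_ _ ys)].
elim: (mup x p) => //= k; rewrite (path_sortedE le_trans) => ->.
rewrite andbT; apply/allP => z; rewrite mem_cat mem_nseq.
by case/orP => [/andP [_ /eqP ->]|/xs'] /=.
Qed.

Lemma mup_prod_XsubC (s : seq R) x : mup x (\prod_(a <- s) ('X - a%:P)) = count_mem x s.
Proof.
elim: s => [|a s IH]; first by rewrite big_nil mupNroot // root1.
rewrite big_cons mupM ?polyXsubC_eq0 ?monic_neq0 ?monic_prod_XsubC ?monicXsubC //.
by rewrite IH /= -['X - a%:P]expr1 mup_XsubCX; case: eqP.
Qed.

Lemma spectrum_symmetric A :
  A^T = A -> char_poly A = \prod_(a <- spectrum A) ('X - a%:P).
Proof.
move=> symA.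
have [s Es] : exists s : seq R, char_poly A = \prod_(a <- s) ('X - a%:P).
  pose C : numClosedFieldType := complex R.
  pose toC : {rmorphism R -> C} := real_complex R.
  pose AC : 'M[C]_m := map_mx toC A.
  have hermA : AC \is hermsymmx.
    apply: realsym_hermsym.
      apply/is_hermitianmxP; rewrite expr0 scale1r map_mx_id //.
      by apply/matrixP => i j; rewrite !mxE -[in LHS]symA mxE.
    by apply/mxOverP => i j; rewrite mxE; apply/complex_realP; exists (A i j).
  have /orthomx_spectralP EA := hermitian_normalmx hermA.
  have realX := hermitian_spectral_diag_real hermA.
  have Pu := spectral_unit AC.
  set X := spectral_diag AC in EA realX.
  set P := spectralmx AC in EA Pu.
  exists [seq complex.Re (X 0 i) | i <- enum 'I_m].
  apply: (map_inj_poly (f := toC)); [exact: (@complexI R)|exact: rmorph0|].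
  have -> : map_poly toC (char_poly A) = char_poly AC by exact: map_char_poly.
  have -> : char_poly AC = char_poly (diag_mx X).
    pose Q := map_mx polyC P; pose Q' := map_mx polyC (invmx P).
    have Q'Q : Q' *m Q = 1%:M by rewrite /Q' /Q -map_mxM mulVmx // map_mx1.
    have -> : char_poly AC = \det (Q' *m char_poly_mx (diag_mx X) *m Q).
      congr (\det _); rewrite /char_poly_mx mulmxBr mulmxBl.
      rewrite (scalar_mxC _ Q') -(mulmxA 'X%:M) Q'Q mulmx1; congr (_ - _).
      by rewrite {1}EA !map_mxM.
    by rewrite !det_mulmx mulrAC -det_mulmx Q'Q det1 mul1r.
  rewrite char_poly_trig; last by apply: diag_mx_is_trig.
  rewrite big_map rmorph_prod big_enum /=; apply: eq_bigr => i _.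
  rewrite rmorphB /= map_polyX map_polyC /=; congr (_ - _%:P).
  rewrite mxE eqxx mulr1n.
  by have /mxOverP/(_ 0 i) := realX; move/RRe_real => ->.
rewrite Es /spectrum Es.
have p0 : \prod_(a <- s) ('X - a%:P) != 0 by rewrite monic_neq0 // monic_prod_XsubC.
apply: perm_big; rewrite perm_sym; apply/permPl/permPl.
rewrite (eq_map (g := fun x => nseq (count_mem x s) x)); last first.
  by move=> x; rewrite mup_prod_XsubC.
rewrite -(permPr (perm_count_undup s)); apply/perm_flatten/perm_map.
apply: uniq_perm; [exact: uniq_roots|exact: undup_uniq|] => x.
have := roots_on_rootsR p0 x.
by rewrite mem_undup root_prod_XsubC in_itv /= => <-.
Qed.
End Spectrum.

(* The orthogonal group O(d). *)
Definition orthogonalmx (R : realType) (d : nat) :=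
  [qualify A : 'M[R]_d | A *m A^T == 1%:M].

Definition frobenius_norm (R : realType) (m n : nat) (A : 'M[R]_(m, n)) : R :=
  Num.sqrt (\sum_i \sum_j A i j ^+ 2).

Section Graph.
Variables (R : realType) (n d : nat).
(* An edge set is not needed as an argument: w vanishes off the edges, so the
   values of rho there are irrelevant. *)
Variables (w : 'M[R]_n) (rho : 'I_n -> 'I_n -> 'M[R]_d).

Definition degree (i : 'I_n) : R := \sum_j w i j.

Definition volume : R := \sum_i degree i.

Definition graph_laplacian : 'M[R]_n :=
  normalized_laplacian (diag_mx (\row_i degree i)) w.

Definition connection_laplacian : 'M[R]_(\sum_(i < n) d) :=
  normalized_laplacian (\mxdiag_(i < n) ((degree i)%:M : 'M[R]_d))
                       (\mxblock_(i < n, j < n) (w i j *: rho i j)).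

Definition frustration (g : 'I_n -> 'M[R]_d) : R :=
  (2 * d%:R)^-1 * volume^-1 *
  \sum_i \sum_j w i j * frobenius_norm (g i - rho i j *m g j) ^+ 2.

(* The infimum is a minimum, see frustration_constant_min. *)
Definition frustration_constant : R :=
  inf [set frustration g | g in [set g | forall i, g i \is orthogonalmx R d]].

Lemma frustration_constant_min :
  exists2 g : 'I_n -> 'M[R]_d, (forall i, g i \is orthogonalmx R d) &
    frustration g = frustration_constant /\
    (forall h : 'I_n -> 'M[R]_d, (forall i, h i \is orthogonalmx R d) ->
       frustration g <= frustration h).
Proof.
pose K := prod_topology (fun _ : 'I_n * ('I_d * 'I_d) => R).
pose G (x : K) (i : 'I_n) : 'M[R]_d := \matrix_(a, b) x (i, (a, b)).
pose A : set K := [set x | forall i, G x i \is orthogonalmx R d].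
have projC k : continuous (fun x : K => x k) by exact: (@proj_continuous _ (fun=> R) k).
have sumC (I : finType) (f : I -> K -> R) :
    (forall i, continuous (f i)) -> continuous (fun x => \sum_i f i x).
  by move=> fC; apply: continuous_big => //; exact: add_continuous.
have mulC (f h : K -> R) :
    continuous f -> continuous h -> continuous (fun x => f x * h x).
  by move=> fC hC x; apply: continuousM; [exact: fC|exact: hC].
have cstC c : continuous (fun _ : K => c : R) by move=> x; exact: cst_continuous.
have clA : closed A.
  have -> : A = \bigcap_(k : 'I_n * ('I_d * 'I_d))
      (fun x : K => \sum_c x (k.1, (k.2.1, c)) * x (k.1, (k.2.2, c))) @^-1`
        [set y | y = (k.2.1 == k.2.2)%:R].
    apply/seteqP; split => [x Ax [i [a b]] _ | x Ax i] /=.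
      have /eqP/matrixP/(_ a b) := Ax i; rewrite !mxE => <-.
      by apply: eq_bigr => c _; rewrite !mxE.
    apply/eqP/matrixP => a b; rewrite !mxE -(Ax (i, (a, b)) I) /=.
    by apply: eq_bigr => c _; rewrite !mxE.
  apply: closed_bigI => k _; apply: preimage_closed; last exact: closed_eq.
  move=> + _; apply: (@sumC) => c; apply: (@mulC); exact: projC.
have cptA : compact A.
  apply: (subclosed_compact clA
    (@tychonoff _ (fun=> R) (fun=> `[-1, 1]%classic)
                (fun=> @segment_compact R (-1) 1))) => x Ax [i [a b]] /=.
  have /eqP/matrixP/(_ a a) := Ax i; rewrite !mxE eqxx /= mulr1n (bigD1 b) //= !mxE => Ex.
  have sum_ge0 : 0 <= \sum_(c | c != b) G x i a c * (G x i)^T c a.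
    by apply: sumr_ge0 => c _; rewrite !mxE -expr2 sqr_ge0.
  by rewrite in_itv /= -ler_norml -(@expr_le1 _ 2) // real_normK ?num_real // -Ex lerDl.
have frustC : continuous (frustration \o G).
  apply: (@mulC); first exact: cstC.
  apply: (@sumC) => i; apply: (@sumC) => j; apply: (@mulC); first exact: cstC.
  have normE : (fun x => frobenius_norm (G x i - rho i j *m G x j) ^+ 2) =
    (fun x => \sum_a \sum_b (x (i, (a, b)) - \sum_c rho i j a c * x (j, (c, b))) ^+ 2).
    apply/funext => x; rewrite sqr_sqrtr; last first.
      by apply: sumr_ge0 => a _; apply: sumr_ge0 => b _; rewrite sqr_ge0.
    apply: eq_bigr => a _; apply: eq_bigr => b _; rewrite !mxE.
    by congr ((_ - _) ^+ 2); apply: eq_bigr => c _; rewrite !mxE.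
  rewrite normE; apply: (@sumC) => a; apply: (@sumC) => b; rewrite /=.
  have subC : continuous (fun x : K =>
      x (i, (a, b)) - \sum_c rho i j a c * x (j, (c, b))).
    move=> x; apply: continuousB; first exact: projC.
    by apply: (@sumC) => c; apply: (@mulC); [exact: cstC|exact: projC].
  exact: mulC.
have A0 : A !=set0.
  exists (fun k => (k.2.1 == k.2.2)%:R) => i.
  rewrite (_ : G _ i = 1%:M); last by apply/matrixP => a b; rewrite !mxE.
  by rewrite qualifE /= trmx1 mulmx1.
have [x /set_mem Ax xmin] := compact_EVT_min A0 cptA (continuous_subspaceT frustC).
have min_x h : (forall i, h i \is orthogonalmx R d) ->
    frustration (G x) <= frustration h.
  move=> hO; pose y : K := fun k => h k.1 k.2.1 k.2.2.
  have Gy : G y = h by apply/funext => i; apply/matrixP => a b; rewrite mxE.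
  by rewrite -Gy; apply: xmin; apply/mem_set; rewrite /A /= Gy.
exists (G x) => //; split => //; apply/eqP; rewrite eq_le; apply/andP; split.
  apply: lb_le_inf; first by exists (frustration (G x)), (G x).
  by move=> _ [h hO <-]; exact: min_x.
apply: ge_inf; last by exists (G x).
by exists (frustration (G x)) => _ [h hO <-]; exact: min_x.
Qed.
End Graph.

(* Main.v *)
Require Import Defs.
From mathcomp Require Import all_boot all_order all_algebra.
From mathcomp Require Import fingroup perm reals ring lra.
Import Order.TTheory GRing.Theory Num.Theory.
Local Open Scope ring_scope.

Set Implicit Arguments.
Unset Strict Implicit.
Unset Printing Implicit Defensive.

(* Lower bound: if g attains the frustration constant, the blocks
   sqrt(d_i / vol) g_i form an orthonormal d-frame, and the Ky Fan principle
   bounds the sum of the d smallest eigenvalues by its trace d * nu(g).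

   Upper bound: let F_i be the blocks of sqrt(vol) D^(-1/2) X, with X a frame of
   d lowest eigenvectors, so that sum_i d_i F_i^T F_i = vol I, and take polar
   decompositions F_i = U_i S_i.  The positive factor A |-> |A| does not see
   rho_ij and is sqrt 2-Lipschitz for the Frobenius norm, so S has Dirichlet
   energy at most twice that of F, and the spectral gap of the graph forces S to
   be close to its mean.  As the mean square of S is I, S is then close to I,
   which makes F close to the orthogonal field U; no truncation is needed, and
   U has frustration at most (24 / d) lambda_2^(-1) sum_i lambda_i. *)

(** * Orthogonal diagonalization, singular values and polar decomposition over the reals *)

Section OrthogonalDiagonalization.
Variable R : realType.

Lemma col_gram_ge0 n (v : 'cV[R]_n) : 0 <= (v^T *m v) 0 0.
Proof. by rewrite mxE; apply: sumr_ge0 => i _; rewrite mxE -expr2 sqr_ge0. Qed.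

Lemma col_gram_eq0 n (v : 'cV[R]_n) : ((v^T *m v) 0 0 == 0) = (v == 0).
Proof.
apply/idP/eqP => [|->]; last by rewrite mulmx0 mxE.
rewrite mxE psumr_eq0 => [/allP v0|i _]; last by rewrite mxE -expr2 sqr_ge0.
apply/matrixP => i j; rewrite ord1.
have /eqP := v0 i (mem_index_enum _); rewrite !mxE -expr2 => /eqP.
by rewrite sqrf_eq0 => /eqP.
Qed.

Lemma normalize_col n (v : 'cV[R]_n) : v != 0 ->
  exists2 c : R, 0 < c & (c *: v)^T *m (c *: v) = 1%:M.
Proof.
rewrite -col_gram_eq0 => v0; set q := (v^T *m v) 0 0 in v0.
have q0 : 0 < q by rewrite lt0r v0 col_gram_ge0.
exists (Num.sqrt q)^-1; first by rewrite invr_gt0 sqrtr_gt0.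
rewrite [(_ *: _)^T]linearZ /= -scalemxAl -scalemxAr scalerA [v^T *m v]mx11_scalar -/q.
by rewrite scale_scalar_mx -invfM -expr2 sqr_sqrtr ?ltW // mulVf.
Qed.

(** The reflection in the hyperplane orthogonal to [v - delta_mx i 0] exchanges these two unit
    vectors; it degenerates when they coincide, and then the identity serves. *)
Lemma householder n (v : 'cV[R]_n) i : v^T *m v = 1%:M ->
  exists2 Q : 'M[R]_n, Q *m Q^T = 1%:M & Q *m v = delta_mx i 0.
Proof.
move=> v1; have [->|vi] := eqVneq v (delta_mx i 0).
  by exists 1%:M; rewrite ?trmx1 mul1mx.
pose u := v - delta_mx i 0; set q := (u^T *m u) 0 0.
have q0 : q != 0 by rewrite /q col_gram_eq0 subr_eq0.
(* As both vectors have norm 1, [q] is twice the inner product of [u] and [v]; hence the reflection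
   subtracts exactly [u] from [v]. *)
have uv : (u^T *m v) = (q / 2)%:M.
  rewrite [LHS]mx11_scalar; congr (_%:M).
  have e1 : (delta_mx i 0 : 'cV[R]_n)^T *m (delta_mx i 0) = 1%:M :> 'M_1.
    by rewrite trmx_delta mul_delta_mx; apply/matrixP => a b; rewrite !mxE !ord1.
  have ve : v^T *m delta_mx i 0 = (delta_mx i 0 : 'cV[R]_n)^T *m v.
    by rewrite -[LHS]trmxK trmx_mul trmxK [RHS]mx11_scalar [X in X^T]mx11_scalar tr_scalar_mx;
       congr (_%:M); rewrite -[in RHS](trmxK (_ *m v)) trmx_mul trmxK mxE.
  rewrite /q /u linearB /= mulmxBr !mulmxBl v1 e1 ve !mxE /= mulr1n.
  by field.
have uu : u^T *m u = q%:M by rewrite [LHS]mx11_scalar.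
have ue : delta_mx i 0 = v - u by rewrite /u subKr.
clearbody q u.
pose Q := 1%:M - (2 / q) *: (u *m u^T).
have Qt : Q^T = Q by rewrite /Q linearB /= [(_ *: _)^T]linearZ /= trmx1 trmx_mul trmxK.
exists Q.
  rewrite Qt /Q mulmxBr mulmx1 mulmxBl mul1mx -scalemxAl -scalemxAr.
  rewrite mulmxA -(mulmxA u) uu mul_mx_scalar -scalemxAl !scalerA -addrA -opprD.
  rewrite -[RHS]subr0; congr (_ - _).
  by rewrite -scalerBl -scalerDl (_ : _ + _ = 0) ?scale0r //; field.
rewrite /Q mulmxBl mul1mx -scalemxAl -mulmxA uv mul_mx_scalar scalerA.
by rewrite (_ : _ * _ = 1) ?scale1r ?ue //; field.
Qed.

Lemma symmetric_unit_eigenvector n (A : 'M[R]_n.+1) : A^T = A ->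
  exists (v : 'cV[R]_n.+1) a, v^T *m v = 1%:M /\ A *m v = a *: v.
Proof.
move=> symA; have EA := spectrum_symmetric symA.
have [a aA] : exists a, a \in spectrum A.
  case: (spectrum A) EA => [|a s] EA; last by exists a; rewrite mem_head.
  by have := size_char_poly A; rewrite EA big_nil size_poly1.
have : eigenvalue A a by rewrite eigenvalue_root_char EA root_prod_XsubC.
case/eigenvalueP => v vA v0.
have [c _ cv] : exists2 c : R, 0 < c & (c *: v^T)^T *m (c *: v^T) = 1%:M.
  by apply: normalize_col; rewrite trmx_eq0.
exists (c *: v^T), a; split=> //.
by rewrite -scalemxAr -{1}symA -trmx_mul vA [(_ *: _)^T]linearZ /= !scalerA mulrC.
Qed.

(** Deflation step of both inductions below. The row and column conditions are separate because the
    matrix of the singular value decomposition is not symmetric. *)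
Lemma block_of_eigenpair n (B : 'M[R]_n.+1) s :
  B *m delta_mx 0 0 = s *: (delta_mx 0 0 : 'cV[R]_n.+1) ->
  delta_mx 0 0 *m B = s *: (delta_mx 0 0 : 'rV[R]_n.+1) ->
  B = block_mx (s%:M : 'M_1) 0 0 (drsubmx (B : 'M_(1 + n))) :> 'M_(1 + n).
Proof.
move=> Bc Br.
have Bi i : B i 0 = s * (i == 0)%:R.
  by have /matrixP/(_ i 0) := Bc; rewrite -colE !mxE eqxx andbT.
have Bj j : B 0 j = s * (j == 0)%:R.
  by have /matrixP/(_ 0 j) := Br; rewrite -rowE !mxE eqxx.
have l0 k : lshift n (k : 'I_1) = 0 by apply/val_inj; rewrite ord1.
have r0 k : (rshift 1 (k : 'I_n) == 0) = false by [].
rewrite -[LHS](@submxK _ 1 n 1 n); congr block_mx; apply/matrixP => i j; rewrite !mxE.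
- by rewrite l0 Bj l0 eqxx mulr1 !ord1.
- by rewrite l0 Bj r0 mulr0.
- by rewrite l0 Bi r0 mulr0.
Qed.

Lemma orthogonal_block_mul n (P : 'M[R]_n) (Q : 'M[R]_(1 + n)) :
  P *m P^T = 1%:M -> Q *m Q^T = 1%:M ->
  (block_mx 1%:M 0 0 P *m Q) *m (block_mx 1%:M 0 0 P *m Q)^T = 1%:M.
Proof.
move=> PP QQ; rewrite trmx_mul mulmxA -(mulmxA _ Q) QQ mulmx1.
rewrite tr_block_mx !trmx0 trmx1 mulmx_block !mulmx0 !mul0mx !addr0 add0r mulmx1 PP.
by rewrite -scalar_mx_block.
Qed.

(** The left and right factors may differ, so that one statement serves the spectral theorem (equal
    factors) and the singular value decomposition. *)
Lemma conj_block n (P P' A : 'M[R]_n) (Q Q' B : 'M[R]_(1 + n)) s (D : 'rV[R]_n) :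
  Q *m B *m Q'^T = block_mx s%:M 0 0 A -> P *m A *m P'^T = diag_mx D ->
  (block_mx 1%:M 0 0 P *m Q) *m B *m (block_mx 1%:M 0 0 P' *m Q')^T
    = diag_mx (row_mx s%:M D).
Proof.
move=> QB PA; rewrite trmx_mul !mulmxA -(mulmxA _ Q B) -(mulmxA _ _ Q'^T) QB.
rewrite tr_block_mx !trmx0 trmx1 !mulmx_block !mulmx0 !mul0mx !addr0 !add0r mul1mx mulmx1.
rewrite mul0mx PA diag_mx_row; congr block_mx; last by rewrite mul0mx.
by apply/matrixP => i j; rewrite !mxE !ord1.
Qed.

Lemma symmetric_diagonalization n (A : 'M[R]_n) : A^T = A ->
  exists (P : 'M[R]_n) (D : 'rV[R]_n), P *m P^T = 1%:M /\ P *m A *m P^T = diag_mx D.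
Proof.
elim: n A => [|n IH] A symA.
  by exists 1%:M, 0; split; apply/matrixP => -[].
have [v [a [v1 Av]]] := symmetric_unit_eigenvector symA.
have [Q QQ Qv] := householder 0 v1.
have Ev : v = Q^T *m delta_mx 0 0 by rewrite -Qv mulmxA (mulmx1C QQ) mul1mx.
pose B : 'M[R]_n.+1 := Q *m A *m Q^T.
have symB : B^T = B by rewrite /B !trmx_mul trmxK symA mulmxA.
have Bc : B *m delta_mx 0 0 = a *: (delta_mx 0 0 : 'cV[R]_n.+1).
  by rewrite /B -mulmxA -Ev -mulmxA Av -scalemxAr Qv.
have Br : delta_mx 0 0 *m B = a *: (delta_mx 0 0 : 'rV[R]_n.+1).
  by rewrite -[LHS]trmxK trmx_mul trmx_delta symB Bc [(_ *: _)^T]linearZ /= trmx_delta.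
have EB := block_of_eigenpair Bc Br.
have [|P [D [PP PA]]] := IH (drsubmx (B : 'M_(1 + n))); first by rewrite trmx_drsub symB.
exists (block_mx 1%:M 0 0 P *m (Q : 'M_(1 + n))), (row_mx a%:M D).
by split; [exact: orthogonal_block_mul | exact: conj_block EB PA].
Qed.

(** Take for [v] a unit eigenvector of [A^T *m A] and for [u] the normalized [A *m v]. If
    [A *m v = 0], then [A] is singular and its left kernel supplies [u], with [s = 0]. *)
Lemma singular_pair n (A : 'M[R]_n.+1) : exists (u v : 'cV[R]_n.+1) (s : R),
  [/\ u^T *m u = 1%:M, v^T *m v = 1%:M, 0 <= s, A *m v = s *: u & u^T *m A = s *: v^T].
Proof.
have [v [a [v1 Av]]] : exists (v : 'cV[R]_n.+1) a,
    v^T *m v = 1%:M /\ (A^T *m A) *m v = a *: v.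
  by apply: symmetric_unit_eigenvector; rewrite trmx_mul trmxK.
have [Av0|Av0] := eqVneq (A *m v) 0.
  have v0 : v != 0.
    by apply/eqP => v0; have /eqP := v1; rewrite v0 mulmx0 eq_sym oner_eq0.
  have /det0P [y y0 yA] : \det A == 0.
    rewrite -det_tr; apply/det0P; exists v^T; first by rewrite trmx_eq0.
    by rewrite -trmx_mul Av0 trmx0.
  have [c _ c1] : exists2 c : R, 0 < c & (c *: y^T)^T *m (c *: y^T) = 1%:M.
    by apply: normalize_col; rewrite trmx_eq0.
  exists (c *: y^T), v, 0; split; rewrite ?scale0r //.
  by rewrite [(_ *: _)^T]linearZ /= trmxK -scalemxAl yA scaler0.
have [c c0 c1] := normalize_col Av0.
(* The eigenvalue [a] is the squared norm of [A *m v], so [c * a] is the singular value [c^-1]. *)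
have ca : c ^+ 2 * a = 1.
  have : (c *: (A *m v))^T *m (c *: (A *m v)) = (c ^+ 2 * a) *: (v^T *m v).
    rewrite [(_ *: _)^T]linearZ /= -scalemxAl -scalemxAr scalerA trmx_mul -mulmxA (mulmxA A^T) Av.
    by rewrite -scalemxAr scalerA.
  by rewrite c1 v1 => /matrixP/(_ 0 0); rewrite !mxE mulr1.
exists (c *: (A *m v)), v, c^-1; split=> //.
- by rewrite invr_ge0 ltW.
- by rewrite scalerA mulVf ?scale1r // gt_eqF.
rewrite [(_ *: _)^T]linearZ /= -scalemxAl -[LHS]trmxK [(_ *: _)^T]linearZ /= trmx_mul trmxK mulmxA Av scalerA [(_ *: _)^T]linearZ /=.
congr (_ *: _); apply: (mulfI (lt0r_neq0 c0)); rewrite mulrA -expr2 ca divff //.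
exact: lt0r_neq0.
Qed.

Lemma singular_value_decomposition n (A : 'M[R]_n) :
  exists (P Q : 'M[R]_n) (D : 'rV[R]_n),
    [/\ P *m P^T = 1%:M, Q *m Q^T = 1%:M, forall i, 0 <= D 0 i &
        P *m A *m Q^T = diag_mx D].
Proof.
elim: n A => [|n IH] A.
  exists 1%:M, 1%:M, 0; split=> [||i|]; last by apply/matrixP => -[].
  - by apply/matrixP => -[].
  - by apply/matrixP => -[].
  - by rewrite mxE.
have [u [v [s [u1 v1 s0 Av uA]]]] := singular_pair A.
have [P PP Pu] := householder 0 u1; have [Q QQ Qv] := householder 0 v1.
pose B : 'M[R]_n.+1 := P *m A *m Q^T.
have Eu : delta_mx 0 0 *m P = u^T.
  by rewrite -[LHS]trmxK trmx_mul trmx_delta -Pu mulmxA (mulmx1C PP) mul1mx.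
have Bc : B *m delta_mx 0 0 = s *: (delta_mx 0 0 : 'cV[R]_n.+1).
  have Ev : v = Q^T *m delta_mx 0 0 by rewrite -Qv mulmxA (mulmx1C QQ) mul1mx.
  by rewrite /B -mulmxA -Ev -mulmxA Av -scalemxAr Pu.
have Br : delta_mx 0 0 *m B = s *: (delta_mx 0 0 : 'rV[R]_n.+1).
  by rewrite /B !mulmxA Eu uA -scalemxAl -trmx_mul Qv trmx_delta.
have EB := block_of_eigenpair Bc Br.
have [P' [Q' [D [PP' QQ' D0 PA]]]] := IH (drsubmx (B : 'M_(1 + n))).
exists (block_mx 1%:M 0 0 P' *m (P : 'M_(1 + n))),
  (block_mx 1%:M 0 0 Q' *m (Q : 'M_(1 + n))), (row_mx s%:M D).
split; [exact: orthogonal_block_mul..| | exact: conj_block EB PA].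
by move=> i; rewrite mxE; case: splitP => j _; rewrite ?mxE ?ord1 ?mulr1n.
Qed.

(** If [P *m A *m Q^T] is a nonnegative diagonal matrix, the orthogonal factor is [P^T *m Q]. The
    positive factor is given as a Gram matrix [C^T *m C], so that traces against it become squared
    norms. *)
Lemma polar_decomposition n (A : 'M[R]_n) :
  exists U C : 'M[R]_n, U *m U^T = 1%:M /\ A = U *m (C^T *m C).
Proof.
have [P [Q [D [PP QQ D0 PA]]]] := singular_value_decomposition A.
pose C := diag_mx (\row_i Num.sqrt (D 0 i)) *m Q.
exists (P^T *m Q), C; split.
  by rewrite trmx_mul trmxK mulmxA -(mulmxA P^T) QQ mulmx1 (mulmx1C PP).
have -> : C^T *m C = Q^T *m diag_mx D *m Q.
  rewrite /C trmx_mul tr_diag_mx mulmxA -[in LHS](mulmxA Q^T) mulmx_diag; congr (_ *m diag_mx _ *m _).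
  by apply/rowP => i; rewrite !mxE -expr2 sqr_sqrtr.
rewrite -PA !mulmxA -(mulmxA P^T) QQ mulmx1 (mulmx1C PP) mul1mx -mulmxA (mulmx1C QQ) mulmx1 //.
Qed.

(** Any orthogonal diagonalization exhibits the roots of the characteristic polynomial on the
    diagonal; permuting the rows of [P] puts them in the order of [spectrum]. *)
Lemma symmetric_spectral_basis n (A : 'M[R]_n) : A^T = A ->
  exists2 P : 'M[R]_n, P *m P^T = 1%:M &
    P *m A *m P^T = diag_mx (\row_i (spectrum A)`_i).
Proof.
move=> symA; have [P [D [PP PA]]] := symmetric_diagonalization symA.
have charA : char_poly A = \prod_(i < n) ('X - (D 0 i)%:P).
  have sim : P *m A = diag_mx D *m P by rewrite -PA -mulmxA (mulmx1C PP) mulmx1.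
  transitivity (char_poly (diag_mx D)).
    pose Q := map_mx polyC P; pose Q' := map_mx polyC P^T.
    have QQ' : Q *m Q' = 1%:M by rewrite -map_mxM PP map_mx1.
    rewrite /char_poly -PA.
    have -> : char_poly_mx (P *m A *m P^T) = Q *m char_poly_mx A *m Q'.
      rewrite /char_poly_mx mulmxBr mulmxBl !map_mxM /= -/Q -/Q'; congr (_ - _).
      by rewrite scalar_mxC -mulmxA QQ' mulmx1.
    by rewrite !det_mulmx mulrAC -det_mulmx QQ' det1 mul1r.
  rewrite char_poly_trig; last exact: diag_mx_is_trig.
  by apply: eq_bigr => i _; rewrite mxE eqxx mulr1n.
have sz : size (spectrum A) = n.
  have := size_char_poly A; rewrite (spectrum_symmetric symA) size_prod_XsubC.
  by case.
pose s := [tuple D 0 i | i < n].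
(* Both lists factor the same polynomial, so each value occurs in both as often as its root
   multiplicity. *)
have : perm_eq (spectrum A) s.
  apply/allP => x _ /=; rewrite -!mup_prod_XsubC -(spectrum_symmetric symA) charA.
  by rewrite big_map big_enum.
case/tuple_permP => p Es.
exists (perm_mx p *m P).
  rewrite trmx_mul mulmxA -(mulmxA (perm_mx p)) PP mulmx1 tr_perm_mx.
  by rewrite -perm_mxM mulgV perm_mx1.
rewrite trmx_mul !mulmxA -(mulmxA (perm_mx p)) -(mulmxA (perm_mx p)) PA tr_perm_mx.
rewrite -row_permE -col_permE; apply/matrixP => i j; rewrite !mxE (inj_eq perm_inj).
by rewrite Es -tnth_nth !tnth_mktuple.
Qed.
End OrthogonalDiagonalization.

(** * The Ky Fan minimum principle *)

Section KyFan.
Variable R : realType.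

Lemma size_spectrum n (A : 'M[R]_n) : A^T = A -> size (spectrum A) = n.
Proof.
move=> symA; have := size_char_poly A.
by rewrite (spectrum_symmetric symA) size_prod_XsubC => -[].
Qed.

Lemma spectrum_nth_le n (A : 'M[R]_n) i j : A^T = A ->
  (i <= j)%N -> (j < n)%N -> (spectrum A)`_i <= (spectrum A)`_j.
Proof.
move=> symA ij jn; apply: (sorted_leq_nth le_trans le_refl) => //.
- exact: spectrum_sorted.
- by rewrite inE size_spectrum // (leq_ltn_trans ij).
- by rewrite inE size_spectrum.
Qed.

Lemma sum_lambdaE n (A : 'M[R]_n) k :
  \sum_(1 <= i < k.+1) lambda i A = \sum_(i < k) (spectrum A)`_i.
Proof. by rewrite big_add1 big_mkord. Qed.

(** In an eigenbasis the trace is a sum of eigenvalues with weights [c i], the diagonal of a rank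
    [k] projection. These weights lie between 0 and 1 and add up to [k], so the sum is least when
    they sit on the [k] smallest eigenvalues. *)
Lemma ky_fan n k (A : 'M[R]_n) (Y : 'M[R]_(n, k)) : A^T = A -> Y^T *m Y = 1%:M ->
  \sum_(1 <= i < k.+1) lambda i A <= \tr (Y^T *m A *m Y).
Proof.
case: k Y => [|k] Y symA YY.
  by rewrite sum_lambdaE big_ord0 /mxtrace big_ord0.
have kn := mulmx1_min YY; rewrite sum_lambdaE.
have [P PP PA] := symmetric_spectral_basis symA.
set D := \row_i _ in PA; pose Z := P *m Y.
have ZZ : Z^T *m Z = 1%:M.
  by rewrite /Z trmx_mul mulmxA -(mulmxA Y^T) (mulmx1C PP) mulmx1.
pose M := Z *m Z^T; pose c i : R := M i i.
have -> : \tr (Y^T *m A *m Y) = \sum_(i < n) (spectrum A)`_i * c i.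
  have -> : Y^T *m A *m Y = Z^T *m (diag_mx D *m Z).
    transitivity (Y^T *m (P^T *m P) *m A *m (P^T *m P) *m Y).
      by rewrite (mulmx1C PP) !mulmx1.
    by rewrite /Z -PA trmx_mul !mulmxA.
  rewrite mxtrace_mulC -mulmxA -/M mul_diag_mx.
  by apply: eq_bigr => i _; rewrite mxE [D 0 i]mxE.
have MM : M *m M = M by rewrite /M mulmxA -(mulmxA Z) ZZ mulmx1.
have symM : M^T = M by rewrite /M trmx_mul trmxK.
have c_sum : \sum_i c i = k.+1%:R by rewrite [LHS]mxtrace_mulC ZZ mxtrace1.
clearbody M.
have c_sq i : c i ^+ 2 <= c i.
  rewrite {2}/c -MM mxE (bigD1 i) //= -expr2 lerDl sumr_ge0 // => j _.
  by rewrite -{2}symM mxE -expr2 sqr_ge0.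
have c_ge0 i : 0 <= c i by apply: le_trans (c_sq i); exact: sqr_ge0.
have c_le1 i : c i <= 1.
  have := c_sq i; have := c_ge0 i; rewrite le_eqVlt => /orP [/eqP <-|ci] //.
  by rewrite expr2 ger_pMr.
pose b i : R := (i < k.+1)%:R.
have b_sum : \sum_(i < n) b i = k.+1%:R.
  transitivity (\sum_(i < k.+1) (1 : R)); last by rewrite sumr_const card_ord.
  rewrite (big_ord_widen n (fun=> 1)) // [RHS]big_mkcond /=.
  by apply: eq_bigr => i _; rewrite /b; case: ifP.
rewrite (big_ord_widen n (fun i => (spectrum A)`_i)) // big_mkcond -subr_ge0 -sumrB.
(* After the case split the frame has [k.+1] columns, so [t] is the largest eigenvalue in the sum.
   Since [c] and [b] have equal totals, shifting by [t] is free, and then each term is a product of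
   two factors of the same sign. *)
set t := (spectrum A)`_k.
rewrite (_ : \sum_i _ = \sum_(i < n) ((spectrum A)`_i - t) * (c i - b i)).
  apply: sumr_ge0 => i _; rewrite /b; case: ltnP => ik.
    apply: mulr_le0; rewrite subr_le0 //; exact: spectrum_nth_le.
  rewrite subr0 mulr_ge0 // subr_ge0; apply: spectrum_nth_le => //.
  exact: ltnW.
transitivity (\sum_(i < n) (((spectrum A)`_i * (c i - b i)) - t * (c i - b i))).
  rewrite [RHS]sumrB -mulr_sumr [in RHS]sumrB c_sum b_sum subrr mulr0 subr0.
  by apply: eq_bigr => i _; rewrite /b mulrBr; case: ifP; rewrite ?mulr1 ?mulr0.
by apply: eq_bigr => i _; rewrite mulrBl.
Qed.

Lemma ky_fan_attained n k (A : 'M[R]_n) : A^T = A -> (k <= n)%N ->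
  exists2 Y : 'M[R]_(n, k), Y^T *m Y = 1%:M &
    \tr (Y^T *m A *m Y) = \sum_(1 <= i < k.+1) lambda i A.
Proof.
move=> symA kn; have [P PP PA] := symmetric_spectral_basis symA.
pose f := widen_ord kn; exists (rowsub f P)^T.
  rewrite trmxK trmx_mxsub -mxsub_mul PP.
  by apply/matrixP => i j; rewrite !mxE -val_eqE.
rewrite trmxK trmx_mxsub mul_rowsub_mx -mxsub_mul PA sum_lambdaE.
by apply: eq_bigr => i _; rewrite !mxE eqxx mulr1n.
Qed.

End KyFan.

(** * Squared Frobenius norm and Dirichlet energy of matrix fields *)

Section DirichletEnergy.
Variable R : realType.

Definition frobenius_sq m n (A : 'M[R]_(m, n)) : R := \tr (A^T *m A).

Lemma frobenius_sqE m n (A : 'M[R]_(m, n)) :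
  frobenius_sq A = \sum_i \sum_j A i j ^+ 2.
Proof.
rewrite exchange_big; apply: eq_bigr => j _; rewrite mxE.
by apply: eq_bigr => i _; rewrite mxE expr2.
Qed.

Lemma frobenius_sq_ge0 m n (A : 'M[R]_(m, n)) : 0 <= frobenius_sq A.
Proof.
rewrite frobenius_sqE; apply: sumr_ge0 => i _; apply: sumr_ge0 => j _.
exact: sqr_ge0.
Qed.

Lemma frobenius_norm_sqr m n (A : 'M[R]_(m, n)) : frobenius_norm A ^+ 2 = frobenius_sq A.
Proof. by rewrite /frobenius_norm -frobenius_sqE sqr_sqrtr // frobenius_sq_ge0. Qed.

Lemma frobenius_sq_orth m n (Q : 'M[R]_m) (A : 'M[R]_(m, n)) :
  Q *m Q^T = 1%:M -> frobenius_sq (Q *m A) = frobenius_sq A.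
Proof.
by move=> /mulmx1C QQ; rewrite /frobenius_sq trmx_mul mulmxA -(mulmxA A^T) QQ mulmx1.
Qed.

Lemma frobenius_sqZ m n a (A : 'M[R]_(m, n)) :
  frobenius_sq (a *: A) = a ^+ 2 * frobenius_sq A.
Proof.
by rewrite /frobenius_sq [(_ *: _)^T]linearZ /= -scalemxAl -scalemxAr scalerA mxtraceZ.
Qed.

Lemma frobenius_sqB m n (A B : 'M[R]_(m, n)) :
  frobenius_sq (A - B) = frobenius_sq A + frobenius_sq B - 2 * \tr (A^T *m B).
Proof.
rewrite /frobenius_sq [(_ - _)^T]linearB /= mulmxBl !mulmxBr !raddfB /=.
have -> : \tr (B^T *m A) = \tr (A^T *m B) by rewrite -mxtrace_tr trmx_mul trmxK.
by rewrite mulr2n mulrDl mul1r; lra.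
Qed.

Lemma frobenius_sq_sum3 m n (A B C : 'M[R]_(m, n)) :
  frobenius_sq (A + B + C) <= 3 * (frobenius_sq A + frobenius_sq B + frobenius_sq C).
Proof.
rewrite !frobenius_sqE -!big_split mulr_sumr /=; apply: ler_sum => i _.
rewrite -!big_split mulr_sumr /=; apply: ler_sum => j _; rewrite !mxE.
have := sqr_ge0 (A i j - B i j); have := sqr_ge0 (B i j - C i j).
by have := sqr_ge0 (A i j - C i j); nra.
Qed.

Variables (n d k : nat) (w : 'M[R]_n) (rho : 'I_n -> 'I_n -> 'M[R]_d).

(** Rectangular values let one energy cover both Laplacians: [d] by [d] fields with the connection
    [rho], and row-valued functions with the trivial connection. *)
Definition dirichlet (f : 'I_n -> 'M[R]_(d, k)) : R :=
  \sum_i \sum_j w i j * frobenius_sq (f i - rho i j *m f j).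

Hypothesis w_sym : forall i j, w i j = w j i.
Hypothesis rho_orth : forall i j, w i j != 0 -> rho i j *m (rho i j)^T = 1%:M.

(** By symmetry of [w] each vertex norm is counted once from either end of an edge, and [rho i j]
    preserves norms on edges. *)
Lemma dirichlet_expand f :
  dirichlet f = 2 * (\sum_i degree w i * frobenius_sq (f i) -
                     \sum_i \sum_j w i j * \tr ((f i)^T *m (rho i j *m f j))).
Proof.
have deg1 : \sum_i degree w i * frobenius_sq (f i) =
    \sum_i \sum_j w i j * frobenius_sq (f i).
  by apply: eq_bigr => i _; rewrite /degree mulr_suml.
have deg2 : \sum_i degree w i * frobenius_sq (f i) =
    \sum_i \sum_j w i j * frobenius_sq (f j).
  rewrite deg1 exchange_big; apply: eq_bigr => i _; apply: eq_bigr => j _.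
  by rewrite w_sym.
rewrite mulrBr [in X in X - _]mulrDl mul1r {1}deg1 deg2 mulr_sumr -!big_split -sumrB.
apply: eq_bigr => i _; rewrite mulr_sumr -!big_split -sumrB; apply: eq_bigr => j _ /=.
have [->|wij] := eqVneq (w i j) 0; first by rewrite !mul0r mulr0 subr0 addr0.
rewrite frobenius_sqB (frobenius_sq_orth _ (rho_orth wij)); ring.
Qed.

End DirichletEnergy.

(** * Quadratic forms of the normalized Laplacians *)

Section LaplacianForms.
Variable R : realType.

Lemma diag_invsqrt_diag n (r : 'rV[R]_n) :
  diag_invsqrt (diag_mx r) = diag_mx (\row_i (Num.sqrt (r 0 i))^-1).
Proof.
by rewrite /diag_invsqrt; congr diag_mx; apply/rowP => i; rewrite !mxE eqxx mulr1n.
Qed.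

Lemma diag_invsqrt_mxdiag n d (c : 'I_n -> R) :
  diag_invsqrt (\mxdiag_(i < n) ((c i)%:M : 'M[R]_d))
    = \mxdiag_(i < n) ((Num.sqrt (c i))^-1%:M : 'M[R]_d).
Proof.
have E (b : 'I_n -> R) : \mxdiag_(i < n) ((b i)%:M : 'M[R]_d) =
    diag_mx (\mxrow_(i < n) (const_mx (b i) : 'rV[R]_d)).
  by rewrite diag_mxrow; apply: eq_mxdiag => i; rewrite diag_const_mx.
by rewrite !E diag_invsqrt_diag; congr diag_mx; apply/rowP => i; rewrite !mxE.
Qed.

Lemma normalized_laplacian_sym n (D W : 'M[R]_n) :
  W^T = W -> (normalized_laplacian D W)^T = normalized_laplacian D W.
Proof.
move=> symW; rewrite /normalized_laplacian [(_ - _)^T]linearB /= trmx1 !trmx_mul symW.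
by rewrite tr_diag_mx mulmxA.
Qed.

Lemma normalized_laplacian_form n k (D W : 'M[R]_n) (X : 'M[R]_(n, k)) :
  let Y := diag_invsqrt D *m X in
  \tr (X^T *m normalized_laplacian D W *m X) = \tr (X^T *m X) - \tr (Y^T *m (W *m Y)).
Proof.
move=> Y; rewrite /normalized_laplacian mulmxBr mulmxBl mulmx1 raddfB /=; congr (_ - \tr _).
by rewrite /Y trmx_mul tr_diag_mx !mulmxA.
Qed.

Variables (n : nat) (w : 'M[R]_n).
Hypothesis w_sym : forall i j, w i j = w j i.
Hypothesis degree_gt0 : forall i, 0 < degree w i.

Lemma sqrt_degree_neq0 i : Num.sqrt (degree w i) != 0.
Proof. by rewrite gt_eqF // sqrtr_gt0. Qed.

Section Connection.
Variables (d k : nat) (rho : 'I_n -> 'I_n -> 'M[R]_d).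
Hypothesis rho_orth : forall i j, w i j != 0 -> rho i j *m (rho i j)^T = 1%:M.
Hypothesis rho_inv : forall i j, w i j != 0 -> rho j i = (rho i j)^T.

(** The substitution by the square root of the degree matrix, which cancels the normalization of the
    Laplacian. *)
Definition degree_section (f : 'I_n -> 'M[R]_(d, k)) :=
  \mxcol_(i < n) (Num.sqrt (degree w i) *: f i).

Lemma degree_section_surj X : exists f, X = degree_section f.
Proof.
exists (fun i => (Num.sqrt (degree w i))^-1 *: submxcol X i).
rewrite -[LHS]submxcolK; apply: eq_mxcol => i.
by rewrite scalerA divff ?scale1r // sqrt_degree_neq0.
Qed.

Lemma degree_section_gram f :
  (degree_section f)^T *m degree_section f = \sum_i degree w i *: ((f i)^T *m f i).
Proof.
rewrite tr_mxcol mul_mxrow_mxcol; apply: eq_bigr => i _.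
rewrite [(_ *: _)^T]linearZ /= -scalemxAl -scalemxAr scalerA -expr2 sqr_sqrtr //.
exact: ltW.
Qed.

Lemma connection_laplacian_sym : (connection_laplacian w rho)^T = connection_laplacian w rho.
Proof.
apply: normalized_laplacian_sym; rewrite tr_mxblock; apply: eq_mxblock => i j.
rewrite [(_ *: _)^T]linearZ /= w_sym; have [->|wij] := eqVneq (w i j) 0.
  by rewrite !scale0r.
by rewrite -rho_inv ?(w_sym j i) // rho_inv ?trmxK // w_sym.
Qed.

(** The factor one half appears because [dirichlet] sums over ordered pairs. *)
Lemma connection_laplacian_form f :
  \tr ((degree_section f)^T *m connection_laplacian w rho *m degree_section f)
    = 2^-1 * dirichlet w rho f.
Proof.
rewrite normalized_laplacian_form degree_section_gram diag_invsqrt_mxdiag mul_mxdiag_mxcol.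
rewrite (eq_mxcol (B_ := fun i => f i)); last first.
  by move=> i; rewrite mul_scalar_mx scalerA mulVf ?scale1r // sqrt_degree_neq0.
rewrite mul_mxblock_mxrow tr_mxcol mul_mxrow_mxcol.
rewrite dirichlet_expand // mulrA mulVf ?mul1r ?pnatr_eq0 //; congr (_ - _).
  by rewrite raddf_sum; apply: eq_bigr => i _; rewrite /= mxtraceZ.
rewrite raddf_sum; apply: eq_bigr => i _; rewrite /= mulmx_sumr raddf_sum /=; apply: eq_bigr => j _.
by rewrite -scalemxAl -scalemxAr mxtraceZ.
Qed.

End Connection.

Section Graph.
Variable k : nat.

(** Counterpart of [degree_section] for the graph Laplacian, whose rows are indexed directly by
    vertices instead of by blocks. *)
Definition degree_rows (f : 'I_n -> 'rV[R]_k) : 'M[R]_(n, k) :=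
  \matrix_i (Num.sqrt (degree w i) *: f i).

Lemma degree_rows_surj X : exists f, X = degree_rows f.
Proof.
exists (fun i => (Num.sqrt (degree w i))^-1 *: row i X).
by apply/row_matrixP => i; rewrite rowK scalerA divff ?scale1r // sqrt_degree_neq0.
Qed.

Lemma rows_form (f g : 'I_n -> 'rV[R]_k) :
  (\matrix_i f i)^T *m (\matrix_i g i) = \sum_i (f i)^T *m g i.
Proof.
apply/matrixP => a b; rewrite mxE summxE; apply: eq_bigr => i _.
by rewrite !mxE big_ord1 !mxE.
Qed.

Lemma degree_rows_gram f :
  (degree_rows f)^T *m degree_rows f = \sum_i degree w i *: ((f i)^T *m f i).
Proof.
rewrite rows_form; apply: eq_bigr => i _.
rewrite [(_ *: _)^T]linearZ /= -scalemxAl -scalemxAr scalerA -expr2 sqr_sqrtr //.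
exact: ltW.
Qed.

Lemma graph_laplacian_sym : (graph_laplacian w)^T = graph_laplacian w.
Proof. by apply: normalized_laplacian_sym; apply/matrixP => i j; rewrite mxE. Qed.

Lemma graph_laplacian_form f :
  \tr ((degree_rows f)^T *m graph_laplacian w *m degree_rows f)
    = 2^-1 * dirichlet w (fun _ _ => 1%:M) f.
Proof.
rewrite normalized_laplacian_form degree_rows_gram diag_invsqrt_diag.
have -> : diag_mx (\row_i (Num.sqrt ((\row_i0 degree w i0) 0 i))^-1) *m degree_rows f =
    \matrix_i f i.
  apply/matrixP => i a; rewrite mul_diag_mx !mxE mulrA.
  by rewrite mulVf ?mul1r // sqrt_degree_neq0.
have -> : w *m (\matrix_i f i) = \matrix_i \sum_j w i j *: f j.
  apply/row_matrixP => i; rewrite rowK row_mul mulmx_sum_row.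
  by apply: eq_bigr => j _; rewrite rowK mxE.
rewrite rows_form.
rewrite dirichlet_expand // => [|*]; last by rewrite trmx1 mulmx1.
rewrite mulrA mulVf ?mul1r ?pnatr_eq0 //; congr (_ - _).
  by rewrite raddf_sum; apply: eq_bigr => i _; rewrite /= mxtraceZ.
rewrite raddf_sum; apply: eq_bigr => i _; rewrite /= mulmx_sumr raddf_sum /=; apply: eq_bigr => j _.
by rewrite mul1mx -scalemxAr mxtraceZ.
Qed.

End Graph.
End LaplacianForms.

(** * The spectral gap of the graph and Poincare inequalities *)

Section SpectralGap.
Variables (R : realType) (n : nat) (w : 'M[R]_n).
Hypothesis w_sym : forall i j, w i j = w j i.
Hypothesis w_ge0 : forall i j, 0 <= w i j.
Hypothesis degree_gt0 : forall i, 0 < degree w i.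

Lemma dirichlet_ge0 d k rho (f : 'I_n -> 'M[R]_(d, k)) : 0 <= dirichlet w rho f.
Proof.
apply: sumr_ge0 => i _; apply: sumr_ge0 => j _.
by rewrite mulr_ge0 // frobenius_sq_ge0.
Qed.

Lemma lambda1_graph_ge0 : 0 <= lambda 1 (graph_laplacian w).
Proof.
have symL := graph_laplacian_sym w_sym; have [n0|n0] := posnP n.
  by rewrite /lambda nth_default // size_spectrum // n0.
have [Y YY] := ky_fan_attained symL n0.
rewrite big_nat1 => <-; have [f ->] := degree_rows_surj degree_gt0 Y.
by rewrite graph_laplacian_form // mulr_ge0 ?invr_ge0 // dirichlet_ge0.
Qed.

Lemma sum_lambda2 m (A : 'M[R]_m) : \sum_(1 <= i < 3) lambda i A = lambda 1 A + lambda 2 A.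
Proof. by rewrite big_ltn // big_nat1. Qed.

(** The squared norm of a difference is at most twice the sum of the squared norms, which bounds the
    sum of the two lowest eigenvalues by 4. This crude bound absorbs a term of the rounding estimate
    that carries no inverse gap. *)
Lemma lambda2_graph_le4 : (1 < n)%N -> lambda 2 (graph_laplacian w) <= 4.
Proof.
move=> n1; have symL := graph_laplacian_sym w_sym.
have [Y YY] := ky_fan_attained symL n1.
have [f EY] := degree_rows_surj degree_gt0 Y.
rewrite EY degree_rows_gram // in YY.
rewrite EY graph_laplacian_form // sum_lambda2 => EL.
suff le4 : dirichlet w (fun _ _ => 1%:M) f <= 8.
  by have := lambda1_graph_ge0; lra.
have deg : \sum_i degree w i * frobenius_sq (f i) = 2.
  have /(congr1 mxtrace) := YY; rewrite raddf_sum mxtrace1 => <-.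
  by apply: eq_bigr => i _; rewrite /= mxtraceZ.
have -> : 8 = 2 * (\sum_i degree w i * frobenius_sq (f i) +
                   \sum_i degree w i * frobenius_sq (f i)) :> R by rewrite deg; lra.
have degE : \sum_i degree w i * frobenius_sq (f i) =
    \sum_i \sum_j w i j * frobenius_sq (f i).
  by apply: eq_bigr => i _; rewrite /degree mulr_suml.
rewrite {1}degE.
have -> : \sum_i degree w i * frobenius_sq (f i) =
    \sum_i \sum_j w i j * frobenius_sq (f j).
  rewrite degE exchange_big; apply: eq_bigr => i _; apply: eq_bigr => j _.
  by rewrite w_sym.
rewrite -big_split mulr_sumr; apply: ler_sum => i _.
rewrite -big_split mulr_sumr; apply: ler_sum => j _ /=.
rewrite -mulrDr mulrCA ler_wpM2l // mul1mx.
rewrite !frobenius_sqE -big_split mulr_sumr; apply: ler_sum => a _.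
rewrite -big_split mulr_sumr; apply: ler_sum => b _ /=; rewrite !mxE.
by have := sqr_ge0 (f i a b + f j a b); nra.
Qed.

Lemma volume_gt0 (i : 'I_n) : 0 < volume w.
Proof.
rewrite /volume (bigD1 i) //= ltr_pwDl // sumr_ge0 // => j _; exact: ltW.
Qed.

(* With [y] the centred function, [ky_fan] for the frame spanned by the weighted
   constant and [y] bounds lambda_1 + lambda_2, and lambda_1 >= 0. *)
Lemma poincare (s : 'I_n -> R) (m := (volume w)^-1 * \sum_i degree w i * s i) :
  lambda 2 (graph_laplacian w) * \sum_i degree w i * (s i - m) ^+ 2
    <= 2^-1 * \sum_i \sum_j w i j * (s i - s j) ^+ 2.
Proof.
pose y i := s i - m.
set N := \sum_i degree w i * _.
have rhs_ge0 : 0 <= 2^-1 * \sum_i \sum_j w i j * (s i - s j) ^+ 2.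
  rewrite mulr_ge0 ?invr_ge0 // sumr_ge0 // => i _; rewrite sumr_ge0 // => j _.
  by rewrite mulr_ge0 // sqr_ge0.
have N_ge0 : 0 <= N.
  by apply: sumr_ge0 => i _; rewrite mulr_ge0 ?sqr_ge0 // ltW.
have [N0|N0] := eqVneq N 0; first by rewrite N0 mulr0.
have N_gt0 : 0 < N by rewrite lt0r N0.
have v_gt0 : 0 < volume w.
  case: (pickP (@predT 'I_n)) => [i _|no]; first exact: volume_gt0.
  by move: N0; rewrite /N big_pred0 ?eqxx // => i; have := no i.
have y_sum : \sum_i degree w i * y i = 0.
  under eq_bigr do rewrite mulrBr; rewrite sumrB -mulr_suml -/(volume w).
  by rewrite /m mulrA divff ?mul1r ?subrr // gt_eqF.
pose c (a : 'I_2) i : R := if a == 0 then (Num.sqrt (volume w))^-1 else (Num.sqrt N)^-1 * y i.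
pose f i : 'rV[R]_2 := \row_a c a i.
have gramE a b : (\sum_i degree w i *: ((f i)^T *m f i)) a b =
    \sum_i degree w i * (c a i * c b i).
  by rewrite summxE; apply: eq_bigr => i _; rewrite !mxE big_ord1 !mxE.
have sq_inv (x : R) : 0 < x -> (Num.sqrt x)^-1 * (Num.sqrt x)^-1 = x^-1.
  by move=> x0; rewrite -invfM -expr2 sqr_sqrtr // ltW.
have gram : (degree_rows w f)^T *m degree_rows w f = 1%:M.
  rewrite degree_rows_gram //; apply/matrixP => a b; rewrite gramE mxE.
  case: (unliftP 0 a) => [a' ->|->]; case: (unliftP 0 b) => [b' ->|->];
    rewrite /c /= ?[a']ord1 ?[b']ord1 /=.
  - under eq_bigr do rewrite mulrACA sq_inv // -expr2 mulrCA.
    by rewrite -mulr_sumr mulVf.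
  - under eq_bigr do rewrite mulrAC mulrCA.
    by rewrite -mulr_sumr y_sum mulr0.
  - under eq_bigr do rewrite (mulrCA (degree w _)) (mulrCA (degree w _)).
    by rewrite -!mulr_sumr y_sum !mulr0.
  - by rewrite -mulr_suml -/(volume w) sq_inv // divff // gt_eqF.
have := ky_fan (graph_laplacian_sym w_sym) gram.
rewrite sum_lambda2 graph_laplacian_form //.
(* The constant column of [f] has no energy, and centring does not affect differences. *)
have -> : dirichlet w (fun _ _ => 1%:M) f = N^-1 * \sum_i \sum_j w i j * (s i - s j) ^+ 2.
  rewrite mulr_sumr; apply: eq_bigr => i _; rewrite mulr_sumr; apply: eq_bigr => j _.
  rewrite mulrCA; congr (_ * _); rewrite mul1mx frobenius_sqE big_ord1 big_ord_recl big_ord1.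
  rewrite !mxE /c /= subrr expr0n add0r -mulrBr exprMn expr2 sq_inv //; congr (_ * _ ^+ 2).
  by rewrite /y; ring.
move=> le; rewrite -ler_pdivlMr // -mulrA [_ / N]mulrC.
by apply: le_trans le; rewrite lerDr; exact: lambda1_graph_ge0.
Qed.

(** The scalar inequality, applied to each matrix entry and summed. *)
Lemma matrix_poincare d k (S : 'I_n -> 'M[R]_(d, k))
    (M := (volume w)^-1 *: \sum_i degree w i *: S i) :
  lambda 2 (graph_laplacian w) * \sum_i degree w i * frobenius_sq (S i - M)
    <= 2^-1 * \sum_i \sum_j w i j * frobenius_sq (S i - S j).
Proof.
have E (p : 'I_n -> 'I_n -> R) (T : 'I_n -> 'I_n -> 'M[R]_(d, k)) :
    \sum_i \sum_j p i j * frobenius_sq (T i j) =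
    \sum_a \sum_b \sum_i \sum_j p i j * T i j a b ^+ 2.
  under eq_bigr do under eq_bigr do rewrite frobenius_sqE mulr_sumr.
  under eq_bigr do under eq_bigr do under eq_bigr do rewrite mulr_sumr.
  under eq_bigr do rewrite exchange_big.
  rewrite exchange_big; apply: eq_bigr => a _.
  under eq_bigr do rewrite exchange_big.
  by rewrite exchange_big.
rewrite E.
have -> : \sum_i degree w i * frobenius_sq (S i - M) =
    \sum_a \sum_b \sum_i degree w i * (S i - M) a b ^+ 2.
  under eq_bigr do rewrite frobenius_sqE mulr_sumr.
  under eq_bigr do under eq_bigr do rewrite mulr_sumr.
  by rewrite exchange_big; apply: eq_bigr => a _; rewrite exchange_big.
rewrite !mulr_sumr; apply: ler_sum => a _; rewrite !mulr_sumr; apply: ler_sum => b _.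
have Mab : M a b = (volume w)^-1 * \sum_i degree w i * S i a b.
  by rewrite mxE summxE; congr (_ * _); apply: eq_bigr => i _; rewrite mxE.
have := poincare (fun i => S i a b); rewrite -Mab.
congr (_ * _ <= _ * _).
  by apply: eq_bigr => i _; rewrite !mxE.
by apply: eq_bigr => i _; apply: eq_bigr => j _; rewrite !mxE.
Qed.
End SpectralGap.

(** * Stability of the positive polar factor *)

Section PolarRounding.
Variable R : realType.

Lemma gram_sym n k (C : 'M[R]_(k, n)) : (C^T *m C)^T = C^T *m C.
Proof. by rewrite trmx_mul trmxK. Qed.

(* For S = C^T C, T = E^T E and W = U^T V, the excess of the right-hand side is
   2 tr(S (W - 1) T (W - 1)^T) + |S - W T W^T|^2, a sum of nonnegative terms. *)
Lemma polar_factor_lipschitz n (U V C E : 'M[R]_n) :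
  U *m U^T = 1%:M -> V *m V^T = 1%:M ->
  frobenius_sq (C^T *m C - E^T *m E)
    <= 2 * frobenius_sq (U *m (C^T *m C) - V *m (E^T *m E)).
Proof.
move=> UU VV; set S := C^T *m C; set T := E^T *m E.
have symS : S^T = S by exact: gram_sym.
have symT : T^T = T by exact: gram_sym.
have pos0 X : 0 <= \tr (S *m X *m T *m X^T).
  have -> : \tr (S *m X *m T *m X^T) = frobenius_sq (C *m X *m E^T).
    rewrite /frobenius_sq [RHS]mxtrace_mulC !trmx_mul trmxK !mulmxA.
    by rewrite [RHS]mxtrace_mulC /S /T !mulmxA.
  exact: frobenius_sq_ge0.
clearbody S T; have [W WE] : {W | W = U^T *m V} by exists (U^T *m V).
have WW : W *m W^T = 1%:M.
  by rewrite WE trmx_mul trmxK mulmxA -(mulmxA U^T) VV mulmx1 (mulmx1C UU).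
have tr1 : \tr (S *m T *m W^T) = \tr (S *m W *m T).
  by rewrite -mxtrace_tr !trmx_mul trmxK symS symT mulmxA mxtrace_mulC mulmxA.
have pos1 : 2 * \tr (S *m W *m T) <= \tr (S *m W *m T *m W^T) + \tr (S *m T).
  have := pos0 (W - 1%:M); rewrite [(_ - _)^T]linearB /= trmx1.
  by rewrite !(mulmxBl, mulmxBr, mulmx1) !raddfB /= tr1; lra.
have pos2 := frobenius_sq_ge0 (S - W *m T *m W^T).
have fW : frobenius_sq (W *m T *m W^T) = frobenius_sq T.
  rewrite -mulmxA frobenius_sq_orth // /frobenius_sq trmx_mul trmxK mulmxA.
  by rewrite mxtrace_mulC !mulmxA (mulmx1C WW) mul1mx.
rewrite frobenius_sqB fW symS !mulmxA in pos2.
rewrite !frobenius_sqB !frobenius_sq_orth // symS trmx_mul symS.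
have -> : S *m U^T *m (V *m T) = S *m W *m T by rewrite WE !mulmxA.
move: pos1 pos2; lra.
Qed.

(** * Averages of positive semidefinite matrices with mean square the identity *)

Section Average.
Variables (n d : nat) (p : 'I_n -> R) (C : 'I_n -> 'M[R]_d).
Let S i := (C i)^T *m C i.
Let v := \sum_i p i.
Hypothesis p_ge0 : forall i, 0 <= p i.
Hypothesis v_gt0 : 0 < v.
Hypothesis gram : \sum_i p i *: (S i *m S i) = v%:M.
Let M := v^-1 *: \sum_i p i *: S i.

(** This is [M <= 1] in the Loewner order, tested against [B]: averaging [2 S <= 1 + S^2] gives
    [2 M <= 2], as the mean of [S^2] is 1. *)
Lemma mean_contraction k (B : 'M[R]_(k, d)) :
  \tr (B *m M *m B^T) <= \tr (B *m B^T).
Proof.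
have le1 i : 2 * \tr (B *m S i *m B^T) <= \tr (B *m B^T) + \tr (B *m (S i *m S i) *m B^T).
  have := frobenius_sq_ge0 (B^T - S i *m B^T).
  rewrite frobenius_sqB /frobenius_sq trmxK trmx_mul trmxK gram_sym !mulmxA; lra.
have h : 2 * \sum_i p i * \tr (B *m S i *m B^T) <= 2 * v * \tr (B *m B^T).
  have e : v * \tr (B *m B^T) = \sum_i p i * \tr (B *m (S i *m S i) *m B^T).
    transitivity (\tr (B *m v%:M *m B^T)).
      by rewrite mul_mx_scalar -scalemxAl mxtraceZ.
    rewrite -gram mulmx_sumr mulmx_suml raddf_sum; apply: eq_bigr => i _.
    by rewrite -scalemxAr -scalemxAl /= mxtraceZ.
  rewrite (_ : 2 * v * _ = v * \tr (B *m B^T) + v * \tr (B *m B^T)); last by ring.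
  rewrite {2}e mulr_suml -big_split mulr_sumr.
  by apply: ler_sum => i _; rewrite /= -mulrDr mulrCA ler_wpM2l.
rewrite /M -scalemxAr -scalemxAl mxtraceZ mulmx_sumr mulmx_suml raddf_sum /=.
rewrite ler_pdivrMl //; move: h; rewrite -mulrA ler_pM2l //; apply: le_trans.
by apply: ler_sum => i _; rewrite -scalemxAr -scalemxAl mxtraceZ.
Qed.

(** The mean square distance of [S] to 1 is [2 (d - tr M)] and that to [M] is [d - tr (M^2)], so the
    claim amounts to [tr (M^2) <= tr M]. *)
Lemma deviation_from_identity :
  \sum_i p i * frobenius_sq (S i - 1%:M) <= 2 * \sum_i p i * frobenius_sq (S i - M).
Proof.
have sum_gram : \sum_i p i * frobenius_sq (S i) = v * d%:R.
  rewrite -mxtrace1 -[v * _]mxtraceZ scalemx1 -gram raddf_sum; apply: eq_bigr => i _.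
  by rewrite /= mxtraceZ /frobenius_sq gram_sym.
have symM : M^T = M.
  rewrite /M [(_ *: _)^T]linearZ /= linear_sum; congr (_ *: _); apply: eq_bigr => i _.
  by rewrite /= [(_ *: _)^T]linearZ /= gram_sym.
have trS B : \sum_i p i * \tr ((S i)^T *m B) = v * \tr (M *m B).
  rewrite /M -scalemxAl mxtraceZ mulrA divff ?gt_eqF // mul1r mulmx_suml raddf_sum.
  by apply: eq_bigr => i _; rewrite /= gram_sym -scalemxAl mxtraceZ.
have dev B : \sum_i p i * frobenius_sq (S i - B) =
    v * d%:R + v * frobenius_sq B - 2 * (v * \tr (M *m B)).
  rewrite -sum_gram -trS [v * _]mulr_suml mulr_sumr -big_split -sumrB.
  by apply: eq_bigr => i _; rewrite /= frobenius_sqB; ring.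
(* The left side averages [tr (S i *m M)], the trace of [C i *m M *m (C i)^T], to which
   [mean_contraction] applies with [B = C i]. *)
have key : \tr (M *m M) <= \tr M.
  rewrite -(ler_pM2l v_gt0) -(trS M) -[M in \tr M]mulmx1 -(trS 1%:M).
  apply: ler_sum => i _; rewrite ler_wpM2l // gram_sym mulmx1 /S.
  by rewrite -mulmxA mxtrace_mulC [leRHS]mxtrace_mulC mean_contraction.
rewrite !dev mulmx1 /frobenius_sq trmx1 mulmx1 mxtrace1 symM.
by move: key; rewrite -(ler_pM2l v_gt0); lra.
Qed.
End Average.
End PolarRounding.

(** * Rounding a field to its orthogonal polar factors *)

Section Rounding.
Variables (R : realType) (n d : nat) (w : 'M[R]_n) (rho : 'I_n -> 'I_n -> 'M[R]_d).
Hypothesis w_sym : forall i j, w i j = w j i.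
Hypothesis w_ge0 : forall i j, 0 <= w i j.
Hypothesis degree_gt0 : forall i, 0 < degree w i.
Hypothesis rho_orth : forall i j, w i j != 0 -> rho i j *m (rho i j)^T = 1%:M.
Hypothesis n_gt1 : (1 < n)%N.

Lemma orthogonal_rounding (F : 'I_n -> 'M[R]_d) :
  \sum_i degree w i *: ((F i)^T *m F i) = (volume w)%:M ->
  exists2 g : 'I_n -> 'M[R]_d, forall i, g i *m (g i)^T = 1%:M &
    lambda 2 (graph_laplacian w) * dirichlet w rho g <= 24 * dirichlet w rho F.
Proof.
move=> gram; have v_gt0 := volume_gt0 degree_gt0 (Ordinal n_gt1).
have [UC UCP] : exists UC : 'I_n -> 'M[R]_d * 'M[R]_d, forall i,
    (UC i).1 *m (UC i).1^T = 1%:M /\ F i = (UC i).1 *m ((UC i).2^T *m (UC i).2).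
  apply: (fin_all_exists (P := fun i X => X.1 *m X.1^T = 1%:M /\ F i = X.1 *m (X.2^T *m X.2))).
  by move=> i; have [U [C UC]] := polar_decomposition (F i); exists (U, C).
pose U i := (UC i).1; pose C i := (UC i).2; pose S i := (C i)^T *m C i.
have UU i : U i *m (U i)^T = 1%:M by have [] := UCP i.
have FE i : F i = U i *m S i by have [] := UCP i.
clearbody U.
have gramS : \sum_i degree w i *: (S i *m S i) = (volume w)%:M.
  rewrite -gram; apply: eq_bigr => i _; congr (_ *: _).
  by rewrite FE trmx_mul mulmxA -(mulmxA _ (U i)^T) (mulmx1C (UU i)) mulmx1 gram_sym.
exists U => //.
set l2 := lambda 2 _.
have l2_le4 : l2 <= 4 by exact: lambda2_graph_le4.
pose M := (volume w)^-1 *: \sum_i degree w i *: S i.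
pose I1 := \sum_i degree w i * frobenius_sq (S i - 1%:M).
have dev : I1 <= 2 * \sum_i degree w i * frobenius_sq (S i - M).
  by apply: deviation_from_identity => // i; exact: ltW.
(* The polar factors of [rho i j *m F j] are [rho i j *m U j] and the unchanged [S j]. *)
have lip : \sum_i \sum_j w i j * frobenius_sq (S i - S j) <= 2 * dirichlet w rho F.
  rewrite mulr_sumr; apply: ler_sum => i _; rewrite mulr_sumr; apply: ler_sum => j _.
  have [->|wij] := eqVneq (w i j) 0; first by rewrite !mul0r mulr0.
  rewrite mulrCA ler_wpM2l // !FE (mulmxA (rho i j)); apply: polar_factor_lipschitz => //.
  by rewrite trmx_mul mulmxA -(mulmxA (rho i j)) UU mulmx1 rho_orth.
have poi : l2 * \sum_i degree w i * frobenius_sq (S i - M) <= dirichlet w rho F.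
  apply: le_trans (matrix_poincare w_sym w_ge0 degree_gt0 S) _.
  by rewrite ler_pdivrMl.
have tri : dirichlet w rho U <= 3 * (dirichlet w rho F + I1 + I1).
  have I1E : I1 = \sum_i \sum_j w i j * frobenius_sq (S i - 1%:M).
    by apply: eq_bigr => i _; rewrite /degree mulr_suml.
  have I1E' : I1 = \sum_i \sum_j w i j * frobenius_sq (S j - 1%:M).
    rewrite I1E exchange_big; apply: eq_bigr => i _; apply: eq_bigr => j _.
    by rewrite w_sym.
  rewrite {1}I1E I1E' -!big_split mulr_sumr; apply: ler_sum => i _ /=.
  rewrite -!big_split mulr_sumr; apply: ler_sum => j _ /=.
  have [->|wij] := eqVneq (w i j) 0; first by rewrite !mul0r !addr0 mulr0.
  rewrite -!mulrDr mulrCA ler_wpM2l //.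
  have -> : U i - rho i j *m U j = (F i - rho i j *m F j) + U i *m (1%:M - S i)
      + rho i j *m (U j *m (S j - 1%:M)).
    by rewrite !FE !mulmxBr !mulmx1; apply/matrixP => a b; rewrite !mxE; ring.
  apply: le_trans (frobenius_sq_sum3 _ _ _) _.
  rewrite !frobenius_sq_orth ?rho_orth //.
  have -> : 1%:M - S i = -1 *: (S i - 1%:M) by rewrite scaleN1r opprB.
  by rewrite frobenius_sqZ sqrrN expr1n mul1r.
have F_ge0 : 0 <= dirichlet w rho F by exact: dirichlet_ge0.
(* A nonpositive [l2] makes the left side nonpositive; otherwise inequalities may be multiplied by
   [l2]. *)
have [l2_le0|l2_gt0] := lerP l2 0.
  apply: (@le_trans _ _ 0); last by rewrite mulr_ge0.
  by rewrite mulr_le0_ge0 // dirichlet_ge0.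
apply: (@le_trans _ _ (l2 * (3 * (dirichlet w rho F + I1 + I1)))).
  by rewrite ler_wpM2l // ltW.
have h1 : l2 * I1 <= 2 * dirichlet w rho F.
  apply: (@le_trans _ _ (l2 * (2 * \sum_i degree w i * frobenius_sq (S i - M)))).
    by rewrite ler_wpM2l // ltW.
  by rewrite mulrCA ler_pM2l.
have h2 : l2 * dirichlet w rho F <= 4 * dirichlet w rho F by rewrite ler_wpM2r.
(* The constant is [24 = 3 * (4 + 2 + 2)]: 4 from [h2] and 2 from each of the two copies of [h1]. *)
by rewrite mulrCA !mulrDr; lra.
Qed.
End Rounding.

(** * Frustration compared with the lowest eigenvalues of the connection Laplacian *)

Section Frustration.
Variables (R : realType) (n d : nat) (w : 'M[R]_n) (rho : 'I_n -> 'I_n -> 'M[R]_d).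

Lemma dirichletZ k a (f : 'I_n -> 'M[R]_(d, k)) :
  dirichlet w rho (fun i => a *: f i) = a ^+ 2 * dirichlet w rho f.
Proof.
rewrite mulr_sumr; apply: eq_bigr => i _; rewrite mulr_sumr; apply: eq_bigr => j _.
by rewrite -scalemxAr -scalerBr frobenius_sqZ mulrCA.
Qed.

Lemma frustrationE g :
  frustration w rho g = (2 * d%:R)^-1 * (volume w)^-1 * dirichlet w rho g.
Proof.
congr (_ * _); apply: eq_bigr => i _; apply: eq_bigr => j _.
by rewrite frobenius_norm_sqr.
Qed.

Hypothesis w_sym : forall i j, w i j = w j i.
Hypothesis w_ge0 : forall i j, 0 <= w i j.
Hypothesis degree_gt0 : forall i, 0 < degree w i.
Hypothesis rho_orth : forall i j, w i j != 0 -> rho i j *m (rho i j)^T = 1%:M.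
Hypothesis rho_inv : forall i j, w i j != 0 -> rho j i = (rho i j)^T.
Hypothesis n_gt1 : (1 < n)%N.

Let v_gt0 : 0 < volume w.
Proof. exact: volume_gt0 degree_gt0 (Ordinal n_gt1). Qed.

Let Lambda := \sum_(1 <= i < d.+1) lambda i (connection_laplacian w rho).

Lemma frustration_lower_bound g : (forall i, g i *m (g i)^T = 1%:M) ->
  d%:R^-1 * Lambda <= frustration w rho g.
Proof.
(* For orthogonal [g i] the degree-weighted Gram sum is the volume times the identity, hence this
   normalization. *)
move=> gO; set c := (Num.sqrt (volume w))^-1.
have c2 : c ^+ 2 = (volume w)^-1 by rewrite exprVn sqr_sqrtr // ltW.
pose f i := c *: g i.
have gram : (degree_section w f)^T *m degree_section w f = 1%:M.
  rewrite degree_section_gram //; transitivity (\sum_i (degree w i * c ^+ 2) *: (1%:M : 'M[R]_d)).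
    apply: eq_bigr => i _; rewrite [(_ *: _)^T]linearZ /= -scalemxAl -scalemxAr.
    by rewrite (mulmx1C (gO i)) !scalerA mulrA.
  by rewrite -scaler_suml -mulr_suml -/(volume w) c2 divff ?scale1r // gt_eqF.
have := ky_fan (connection_laplacian_sym w_sym rho_inv) gram.
rewrite connection_laplacian_form // dirichletZ c2 -/Lambda frustrationE invfM.
by move=> h; rewrite -2!mulrA mulrCA ler_wpM2l // invr_ge0.
Qed.

(** An optimal eigenvector frame, rescaled to Gram sum [volume w], is rounded. The nonnegativity of
    [Lambda] is recorded as well, since enlarging the constant in front of it relies on it. *)
Lemma frustration_upper_bound : exists2 g : 'I_n -> 'M[R]_d,
  forall i, g i *m (g i)^T = 1%:M &
  lambda 2 (graph_laplacian w) * (d%:R * frustration w rho g) <= 24 * Lambda /\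
  0 <= Lambda.
Proof.
have dn : (d <= \sum_(i < n) d)%N by rewrite sum_nat_const card_ord leq_pmull // ltnW.
have [X XX] := ky_fan_attained (connection_laplacian_sym w_sym rho_inv) dn.
have [f EX] := degree_section_surj degree_gt0 X.
rewrite EX degree_section_gram // in XX.
rewrite EX connection_laplacian_form // -/Lambda => EL.
set c := Num.sqrt (volume w).
have c2 : c ^+ 2 = volume w by rewrite sqr_sqrtr // ltW.
have gram : \sum_i degree w i *: ((c *: f i)^T *m (c *: f i)) = (volume w)%:M.
  rewrite -[RHS]scalemx1 -XX scaler_sumr; apply: eq_bigr => i _.
  rewrite [(_ *: _)^T]linearZ /= -scalemxAl -scalemxAr !scalerA -c2.
  by rewrite -mulrA mulrC.
have [g gO gle] := orthogonal_rounding w_sym w_ge0 degree_gt0 rho_orth n_gt1 gram.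
exists g => //; split; last by rewrite -EL mulr_ge0 ?invr_ge0 // dirichlet_ge0.
rewrite frustrationE -EL; rewrite dirichletZ c2 in gle.
(* The cancellation of [d%:R] below requires [d] to be nonzero; at [d = 0] the left side
   vanishes. *)
have [d0|d_gt0] := posnP d.
  by rewrite {1}d0 mul0r mulr0 !mulr_ge0 ?invr_ge0 // dirichlet_ge0.
have -> : lambda 2 (graph_laplacian w) *
    (d%:R * ((2 * d%:R)^-1 / volume w * dirichlet w rho g)) =
    (2 * volume w)^-1 * (lambda 2 (graph_laplacian w) * dirichlet w rho g).
  by field; rewrite gt_eqF // pnatr_eq0 -lt0n d_gt0.
rewrite ler_pdivrMl ?mulr_gt0 //; apply: le_trans gle _; rewrite le_eqVlt; apply/orP; left.
by apply/eqP; field.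
Qed.
End Frustration.

(** * Two-sided spectral bound for the frustration constant *)

Theorem theorem2p6 (R : realType) (n d : nat) (E : rel 'I_n) (w : 'M[R]_n)
    (rho : 'I_n -> 'I_n -> 'M[R]_d)
    (d_ge1 : (1 <= d)%N)
    (E_sym : symmetric E) (E_irr : irreflexive E)
    (w_sym : forall i j, w i j = w j i)
    (w_edge : forall i j, E i j -> 0 < w i j)
    (w_nonedge : forall i j, ~~ E i j -> w i j = 0)
    (degree_gt0 : forall i, 0 < degree w i)
    (rho_orth : forall i j, E i j -> rho i j \is orthogonalmx R d)
    (rho_inv : forall i j, E i j -> rho j i = invmx (rho i j))
    (gap : 0 < lambda 2 (graph_laplacian w)) :
  d%:R^-1 * \sum_(1 <= i < d.+1) lambda i (connection_laplacian w rho)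
    <= frustration_constant w rho
  /\
  frustration_constant w rho
    <= 1026 * d%:R ^+ 3 * (lambda 2 (graph_laplacian w))^-1 *
       \sum_(1 <= i < d.+1) lambda i (connection_laplacian w rho).
Proof.
have w_ge0 i j : 0 <= w i j.
  by have [/w_edge/ltW|/w_nonedge ->] := boolP (E i j).
have wE i j : w i j != 0 -> E i j.
  by apply: contraNT => /w_nonedge ->.
have orthE i j : w i j != 0 -> rho i j *m (rho i j)^T = 1%:M.
  by move=> /wE /rho_orth /eqP.
have invE i j : w i j != 0 -> rho j i = (rho i j)^T.
  move=> wij; rewrite rho_inv ?wE //; have rr := orthE _ _ wij.
  have [u _] := mulmx1_unit rr.
  by rewrite -[RHS]mul1mx -(mulVmx u) -mulmxA rr mulmx1.
(* With at most one vertex, [lambda 2] would be the default value 0 of an out-of-range entry,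
   contradicting [gap]. *)
have n_gt1 : (1 < n)%N.
  rewrite ltnNge; apply: contraTN gap => n_le1.
  by rewrite /lambda nth_default ?ltxx // size_spectrum // graph_laplacian_sym.
have [gm gmO [<- gm_min]] := frustration_constant_min w rho.
split.
  by apply: frustration_lower_bound => // i; exact/eqP/gmO.
have [g gO [g_le L_ge0]] := frustration_upper_bound w_sym w_ge0 degree_gt0 orthE invE n_gt1.
apply: (le_trans (gm_min g _)) => [i|]; first exact/eqP/gO.
have d1 : 1 <= d%:R :> R by rewrite ler1n.
have d0 : 0 < d%:R :> R by exact: lt_le_trans d1.
rewrite mulrAC ler_pdivlMr // mulrC -(ler_pM2l d0) mulrCA; apply: le_trans g_le _.
rewrite mulrA ler_wpM2r // mulrCA -exprS.
(* After multiplication by [d] it remains to see that 24 is at most [1026 * d ^ 4]. *)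
have := exprn_ege1 4 d1; lra.
Qed.
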